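(* Let $N\ge 2$ and let $u^1,\dots,u^{N+1}$ be coordinates (on the open set where the map below is a local diffeomorphism). Let $m^{ij}$ be the $(N+1)\times(N+1)$ symmetric constant matrix with $m^{ii}=2-N$ for $1\le i\le N$, $m^{N+1,N+1}=N$, and $m^{ij}=1$ for $i\ne j$, and consider the pair $$g^{ij}(u)=m^{ij}u^iu^j,\qquad \Gamma^{ij}_k(u)=\delta^j_k\,m^{ij}u^i\quad(\text{no summation}).$$ Define new coordinates $s^1,\dots,s^{N+1}$ by $$s^r=\sum_{n=0}^{r}(-1)^n\sigma^{r-n}(u^{N+1})^n\ (r=1,\dots,N),\qquad s^{N+1}=u^{N+1},$$ where $\sigma^0=1$ and $\sigma^r$ are the elementary symmetric polynomials of $u^1,\dots,u^N$. Equivalently, $\frac{\prod_{i=1}^N(p+u^i)}{p+u^{N+1}}=\sum_{n=0}^{N-1}p^ns^{N-1-n}+\frac{s^N}{p+s^{N+1}}$ with $s^0=1$. Transform the pair to the $s$-coordinates by $$g^{ij}(s)=\frac{\partial s^i}{\partial u^p}\frac{\partial s^j}{\partial u^q}g^{pq}(u),\qquad \Gamma^{ij}_k(s)=\frac{\partial s^i}{\partial u^p}\frac{\partial s^j}{\partial u^q}\frac{\partial u^r}{\partial s^k}\Gamma^{pq}_r(u)+\frac{\partial s^i}{\partial u^p}\frac{\partial^2 s^j}{\partial u^q\partial u^r}\frac{\partial u^r}{\partial s^k}g^{pq}(u)$$ (summation over repeated indices). Then all components $g^{ij}(s)$ and $\Gamma^{ij}_k(s)$, regarded as functions of $s^1,\dots,s^{N+1}$,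 depend linearly (affinely) on the coordinate $s^{N-1}$.
   Context: The pair $(g,\Gamma)$ defines the (degenerate) Hamiltonian structure of hydrodynamic type $\{u^i(x),u^j(y)\}=g^{ij}\delta'(x-y)+\Gamma^{ij}_ku^k_x\delta(x-y)$ associated with the rational Lax function $\mathcal L=\prod_{i=1}^N(p+u^i)/(p+u^{N+1})$; the stated transformation rule for $(g,\Gamma)$ is the one induced on the coefficients of this bracket by the change of fields $u\mapsto s$. ''Depend linearly on $s^{N-1}$'' means the second partial derivative with respect to $s^{N-1}$ (other $s^j$ held fixed) vanishes. *)

(* Defs.v *)
From HB Require Import structures.
From mathcomp Require Import all_boot all_order all_algebra.
From mathcomp Require Import fraction.
From mathcomp Require Import mpoly.
Unset Printing Implicit Defensive.
Import Order.TTheory GRing.Theory Num.Theory.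
Local Open Scope ring_scope.

Notation "x %:F" := (@FracField.tofrac _ x) : ring_scope.

(* Coordinates are indexed 0..N (0-based): index i stands for u^(i+1);
   in particular u^(N+1) is [ord_max]. *)

Definition RatFun (R : numFieldType) (N : nat) := {fraction {mpoly R[N.+1]}}.

(* Formal partial derivative d/du^i on rational functions (quotient rule on
   any representative n/d; this is well defined). *)
Definition fderiv (R : numFieldType) (N : nat) (i : 'I_N.+1)
    (x : RatFun R N) : RatFun R N :=
  let n := \n_(repr x) in let d := \d_(repr x) in
  (mderiv i n * d - n * mderiv i d)%:F / (d ^+ 2)%:F.

Definition mcoef (R : numFieldType) (N : nat) (i j : 'I_N.+1) : R :=
  if i == j then (if i == ord_max then N%:R else 2%:R - N%:R) else 1.

Definition g_u (R : numFieldType) (N : nat) (i j : 'I_N.+1) : {mpoly R[N.+1]} :=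
  mcoef R N i j *: ('X_i * 'X_j).

Definition Gam_u (R : numFieldType) (N : nat) (i j k : 'I_N.+1) : {mpoly R[N.+1]} :=
  if j == k then mcoef R N i j *: 'X_i else 0.

Definition sigma (R : numFieldType) (N : nat) (k : nat) : {mpoly R[N.+1]} :=
  \sum_(A : {set 'I_N.+1} | (#|A| == k) && (ord_max \notin A))
     \prod_(i in A) 'X_i.

(* The new coordinates s (0-based index r stands for s^(r+1)):
   s^r = sum_{n=0}^r (-1)^n sigma^{r-n} (u^{N+1})^n  (r = 1..N),
   s^{N+1} = u^{N+1}. *)
Definition s_u (R : numFieldType) (N : nat) (r : 'I_N.+1) : {mpoly R[N.+1]} :=
  if r == ord_max then 'X_(@ord_max N) else
  \sum_(n < r.+2) ((-1) ^+ n *: (sigma R N (r.+1 - n) * 'X_(@ord_max N) ^+ n)).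

Definition jac (R : numFieldType) (N : nat) : 'M[RatFun R N]_N.+1 :=
  \matrix_(p, q) (mderiv q (s_u R N p))%:F.

Definition jacinv (R : numFieldType) (N : nat) : 'M[RatFun R N]_N.+1 :=
  invmx (jac R N).

Definition hess (R : numFieldType) (N : nat) (j q r : 'I_N.+1) : RatFun R N :=
  (mderiv r (mderiv q (s_u R N j)))%:F.

Definition g_s (R : numFieldType) (N : nat) (i j : 'I_N.+1) : RatFun R N :=
  \sum_p \sum_q jac R N i p * jac R N j q * (g_u R N p q)%:F.

Definition Gam_s (R : numFieldType) (N : nat) (i j k : 'I_N.+1) : RatFun R N :=
  \sum_p \sum_q \sum_r
     (jac R N i p * jac R N j q * jacinv R N r k * (Gam_u R N p q r)%:F
      + jac R N i p * hess R N j q r * jacinv R N r k * (g_u R N p q)%:F).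

(* partial derivative d/ds^k of a function expressed in the u coordinates
   (chain rule: d/ds^k = sum_r du^r/ds^k d/du^r) *)
Definition sderiv (R : numFieldType) (N : nat) (k : 'I_N.+1)
    (F : RatFun R N) : RatFun R N :=
  \sum_r jacinv R N r k * fderiv R N r F.

Definition affine_in_s (R : numFieldType) (N : nat) (k : 'I_N.+1)
    (F : RatFun R N) : Prop :=
  sderiv R N k (sderiv R N k F) = 0.

(* Main.v *)
Require Import Defs.
From HB Require Import structures.
From mathcomp Require Import all_boot all_order all_algebra.
From mathcomp Require Import fraction.
From mathcomp Require Import mpoly.
From mathcomp Require Import ring zify.
Import GRing.Theory Num.Theory.
Local Open Scope ring_scope.

(** Write [v = u^(N+1)], [E_p = u^p d/du^p] and [e_p = 1] for [p <= N],
    [e_p = -1] for [p = N+1], so that [m^(pq) = 1 + (1-N) e_p delta_(pq)].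
    Since [s^r] has weight [r],
      [g^(ij) = (ij) s^i s^j + (1-N) sum_p e_p (E_p s^i) (E_p s^j)] and
      [Gamma^(ij)_k = (i s^i) d_k (j s^j)
                      + (1-N) sum_p e_p (E_p s^i) d_k (E_p s^j)]
    with [d_k = d/ds^k].  The formula for [s^r] makes sense for all [r >= 0]
    (the elementary symmetric polynomials of the "super" alphabet
    [u^1..u^N | v]), with [s^(r+1) = - v s^r] for [r >= N], and for every [p]
    the functions [F_p^a = e_p E_p s^a] satisfy
    [F_p^(a+1) = u^p (s^a - F_p^a)].  This gives recurrences expressing the sums
    over [p] as combinations of the [s^c s^d], resp. of the [s^c d_k s^d].
    As [d_k s^d] does not involve [s^(N-1)], Gamma is affine in [s^(N-1)]; the
    only quadratic term in [g] can come from [i = j = N-1], where it has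
    coefficient [(N-1)^2 + (1-N)(N-1) = 0].  The components with an index [N+1]
    are linear in the [s^c] with coefficients in [v]. *)

(** * Exchange recurrences for sums over a signed alphabet *)

Section SignedAlphabet.

Variables (K : comNzRingType) (I : finType) (u eps : I -> K).
Variables (s : nat -> K) (G : I -> nat -> K).
Hypothesis s0 : s 0 = 1.
Hypothesis G0 : forall p, G p 0 = 1.
Hypothesis GS : forall p a, G p a.+1 = s a.+1 - u p * G p a.

(* [u p], [eps p], [s a] and [eps p * G p a] play the roles of [u^p], [e_p],
   [s^a] and [d s^(a+1) / d u^p]; then [F p a] is [F_p^a]. *)
Local Notation F p a := (s a - G p a).

Hypothesis euler : forall a, \sum_p eps p * F p a = a%:R * s a.

(** By [GS], [F p a.+1 = u p * G p a], so [u p * G p a * G p b] cancels between the two products.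
    What is left is linear in [F] and is summed by [euler]. *)
Lemma sum_FF_rec a b :
  \sum_p eps p * F p a.+1 * F p b
  = \sum_p eps p * F p a * F p b.+1
    + a.+1%:R * (s a.+1 * s b) - b.+1%:R * (s a * s b.+1).
Proof.
have -> : a.+1%:R * (s a.+1 * s b) = s b * \sum_p eps p * F p a.+1.
  by rewrite euler; ring.
have -> : b.+1%:R * (s a * s b.+1) = s a * \sum_p eps p * F p b.+1.
  by rewrite euler; ring.
rewrite !mulr_sumr -big_split -sumrB; apply: eq_bigr => p _ /=.
by rewrite !GS; ring.
Qed.

(** Iterating the recurrence down to [F p 0 = 0] leaves an integer combination of products
    [s c * s d], of which [phi] (later a second derivative) sees only [s m * s m]. That product
    occurs once, with coefficient [m], if [a = b = m]; if [a + b = 2m] with [a > m], it occurs twice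
    and cancels. *)
Lemma sum_FF_additive (phi : {additive K -> K}) m z :
  (forall c d, phi (s c * s d) = if (c == m) && (d == m) then z else 0) ->
  forall a b, phi (\sum_p eps p * F p a * F p b)
    = if (a == m) && (b == m) then z *+ m else 0.
Proof.
move=> phiE; elim=> [|a IHa] b.
  rewrite big1 ?raddf0 => [|p _]; last by rewrite s0 G0; ring.
  by case: m {phiE} => [|m] //=; rewrite mulr0n if_same.
rewrite sum_FF_rec raddfB raddfD !mulr_natl !(raddfMn phi) /= !phiE IHa.
case: (a.+1 =P m); case: (b =P m); case: (a =P m); case: (b.+1 =P m) => /=;
  try lia.
(* Two cases are not immediate: [a.+1 = b = m], where the new term gives [z *+ m], and
   [a = b.+1 = m], where the induction hypothesis cancels the last term. *)
all: move=> *; rewrite ?mul0rn ?subr0 ?addr0 ?add0r //.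
  by congr (_ *+ _); lia.
by rewrite -[RHS](subrr (z *+ m)); congr (_ - _); congr (_ *+ _); lia.
Qed.

Section Derivation.

Variable d : {additive K -> K}.
Hypothesis derM : forall x y, d (x * y) = d x * y + x * d y.
Hypothesis d_eps : forall p, d (eps p) = 0.
Hypothesis chain : forall b, d (s b.+1) = \sum_p eps p * G p b * d (u p).

(** Again [u p * G p a * G p b] cancels; [chain] sums the terms linear in [G]. *)
Lemma sum_GGd_rec a b :
  \sum_p eps p * G p a.+1 * G p b * d (u p)
  = \sum_p eps p * G p a * G p b.+1 * d (u p)
    + s a.+1 * d (s b.+1) - s b.+1 * d (s a.+1).
Proof.
rewrite !chain !mulr_sumr -big_split -sumrB; apply: eq_bigr => p _ /=.
by rewrite !GS; ring.
Qed.

(** The exchange is that of [sum_FF_rec], but [d] also hits the factor [u p] of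
    [F p b.+1 = u p * G p b]; this produces the last sum. *)
Lemma sum_FdF_rec a b :
  \sum_p eps p * F p a.+1 * d (F p b)
  = \sum_p eps p * F p a * d (F p b.+1)
    + a.+1%:R * (s a.+1 * d (s b)) - b.+1%:R * (s a * d (s b.+1))
    + \sum_p eps p * G p a * G p b * d (u p).
Proof.
have -> : a.+1%:R * (s a.+1 * d (s b)) = d (s b) * \sum_p eps p * F p a.+1.
  by rewrite euler; ring.
(* This is [euler] differentiated, the signs being constants for [d]. *)
have -> : b.+1%:R * (s a * d (s b.+1)) = s a * \sum_p eps p * d (F p b.+1).
  rewrite mulrCA; congr (_ * _).
  rewrite mulr_natl -raddfMn -mulr_natl -euler raddf_sum.
  by apply: eq_bigr => p _ /=; rewrite derM d_eps mul0r add0r.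
rewrite !mulr_sumr -big_split -sumrB -big_split; apply: eq_bigr => p _ /=.
by rewrite !GS !(raddfB, derM) /=; ring.
Qed.

Lemma sum_FdF_additive (phi : {additive K -> K}) :
  (forall c e, phi (s c * d (s e)) = 0) ->
  forall a b, phi (\sum_p eps p * F p a * d (F p b)) = 0.
Proof.
move=> phiE.
(* The extra sums come first: at [a = 0] they collapse by [chain] to [s 0 * d (s b.+1)]. *)
have phiT : forall a b, phi (\sum_p eps p * G p a * G p b * d (u p)) = 0.
  elim=> [|a IHa] b.
    rewrite (eq_bigr (fun p => eps p * G p b * d (u p))) => [|p _].
      by rewrite -chain -[d _]mul1r -s0 phiE.
    by rewrite G0 mulr1.
  by rewrite sum_GGd_rec raddfB raddfD /= IHa !phiE addr0 subr0.
elim=> [|a IHa] b.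
  by rewrite big1 ?raddf0 // => p _; rewrite s0 G0; ring.
rewrite sum_FdF_rec raddfD raddfB raddfD /= IHa phiT !mulr_natl.
by rewrite !(raddfMn phi) /= !phiE !mul0rn !addr0 subr0.
Qed.

End Derivation.
End SignedAlphabet.

(** * Formal partial derivatives as derivations of the field of rational functions *)

Lemma frac_numden (D : idomainType) (x : {fraction D}) :
  x = (\n_(repr x))%:F / (\d_(repr x))%:F.
Proof.
have d0 : (\d_(repr x))%:F != 0 by rewrite tofrac_eq0 denom_ratioP.
apply: (mulIf d0); rewrite divfK //.
rewrite -{1}[x]reprK; unlock FracField.tofrac.
rewrite -[LHS]FracField.pi_mul; apply/eqmodP.
rewrite /= FracField.equivfE /FracField.mulf.
rewrite !numden_Ratio ?mulf_neq0 ?oner_eq0 ?denom_ratioP //.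
by rewrite !mulr1 mulrC.
Qed.

Section RationalFunctions.

Variables (R : numFieldType) (N : nat).
Local Notation K := (RatFun R N).
Local Notation P := {mpoly R[N.+1]}.

Lemma frac_ind (Q : K -> Prop) :
  (forall a b : P, b != 0 -> Q (a%:F / b%:F)) -> forall x, Q x.
Proof. by move=> QF x; rewrite [x]frac_numden; apply/QF/denom_ratioP. Qed.

(** This frees [fderiv] from the representative chosen by [repr]. *)
Lemma fderiv_frac i (a b : P) : b != 0 ->
  fderiv R N i (a%:F / b%:F)
  = (mderiv i a * b - a * mderiv i b)%:F / (b ^+ 2)%:F.
Proof.
move=> b0; rewrite /fderiv; set x := a%:F / b%:F.
have d0 := denom_ratioP (repr x); have := frac_numden _ x.
move: (\n_(repr x)) (\d_(repr x)) d0 => n d d0 /eqP.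
rewrite /x eqr_div ?tofrac_eq0 // -!tofracM tofrac_eq => /eqP eq_ad.
apply/eqP; rewrite eqr_div ?tofrac_eq0 ?expf_neq0 // -!tofracM tofrac_eq.
have /(congr1 (mderiv i)) := eq_ad; rewrite !mderivM => eq_ad'.
(* With [q = a * d = n * b], both sides equal [q' * (d * b) - q * (d * b)']. *)
apply/eqP; transitivity ((mderiv i n * b + n * mderiv i b) * (d * b)
   - n * b * (mderiv i b * d + mderiv i d * b)); first ring.
by rewrite -eq_ad' -eq_ad; ring.
Qed.

Lemma fderiv_tofrac i (a : P) : fderiv R N i a%:F = (mderiv i a)%:F.
Proof.
rewrite -[a%:F]divr1 -tofrac1 fderiv_frac ?oner_eq0 //.
by rewrite mulr1 expr1n tofrac1 divr1 -mpolyC1 mderivC mulr0 subr0.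
Qed.

Lemma fderivB i : zmod_morphism (fderiv R N i).
Proof.
elim/frac_ind=> a b b0; elim/frac_ind=> c d d0.
have -> : a%:F / b%:F - c%:F / d%:F = (a * d - c * b)%:F / (b * d)%:F :> K.
  by rewrite tofracB !tofracM -mulNr addf_div ?tofrac_eq0 // mulNr.
rewrite !fderiv_frac ?mulf_neq0 //.
rewrite -[X in _ = _ + X]mulNr -tofracN addf_div ?tofrac_eq0 ?expf_neq0 //.
apply/eqP; rewrite eqr_div ?mulf_neq0 ?tofrac_eq0 ?expf_neq0 ?mulf_neq0 //.
rewrite -!(tofracM, tofracD) tofrac_eq !(mderivB, mderivM).
by apply/eqP; ring.
Qed.

HB.instance Definition _ i :=
  GRing.isZmodMorphism.Build K K (fderiv R N i) (fderivB i).

Lemma fderivM i x y :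
  fderiv R N i (x * y) = fderiv R N i x * y + x * fderiv R N i y.
Proof.
elim/frac_ind: x => a b b0; elim/frac_ind: y => c d d0.
rewrite mulf_div -!tofracM !fderiv_frac ?mulf_neq0 // !mulf_div -!tofracM.
rewrite addf_div ?tofrac_eq0 ?mulf_neq0 ?expf_neq0 //.
apply/eqP; rewrite eqr_div ?mulf_neq0 ?tofrac_eq0 ?expf_neq0 ?mulf_neq0 //.
rewrite -!(tofracM, tofracD) tofrac_eq !mderivM.
by apply/eqP; ring.
Qed.

Lemma sderivB k : zmod_morphism (sderiv R N k).
Proof.
move=> x y; rewrite /sderiv -sumrB; apply: eq_bigr => r _.
by rewrite raddfB mulrBr.
Qed.

HB.instance Definition _ k :=
  GRing.isZmodMorphism.Build K K (sderiv R N k) (sderivB k).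

Lemma sderivM k x y :
  sderiv R N k (x * y) = sderiv R N k x * y + x * sderiv R N k y.
Proof.
rewrite /sderiv mulr_suml mulr_sumr -big_split; apply: eq_bigr => r _ /=.
by rewrite fderivM; ring.
Qed.

Lemma sderiv1 k : sderiv R N k 1 = 0.
Proof.
rewrite /sderiv big1 // => r _.
by rewrite -tofrac1 fderiv_tofrac -mpolyC1 mderivC tofrac0 mulr0.
Qed.

End RationalFunctions.

(** * The functions s^r for all r and their first derivatives *)

Section Coordinates.

Variables (R : numFieldType) (N : nat).
Local Notation P := {mpoly R[N.+1]}.
Local Notation v := ('X_(@ord_max N) : P).

Lemma mderiv1 (i : 'I_N.+1) : mderiv i (1 : P) = 0.
Proof. by rewrite -mpolyC1 mderivC. Qed.

Lemma mderiv_var (i j : 'I_N.+1) : mderiv i ('X_j : P) = (i == j)%:R.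
Proof.
rewrite mderivX mnm1E eq_sym; case: eqP => [->|_]; last by rewrite scale0r.
have -> : (U_(j) - U_(j) = 0)%MM by apply/mnmP=> l; rewrite mnmBE subnn mnm0E.
by rewrite scale1r mpolyX0.
Qed.

Lemma mderiv_prod_notin (i : 'I_N.+1) (A : {set 'I_N.+1}) :
  i \notin A -> mderiv i (\prod_(j in A) ('X_j : P)) = 0.
Proof.
move=> iA; elim/big_ind: _ => [|x y x0 y0|j jA]; first exact: mderiv1.
  by rewrite mderivM x0 y0 mul0r mulr0 addr0.
by rewrite mderiv_var; case: eqP jA iA => // -> ->.
Qed.

Definition sigma_omit (p : 'I_N.+1) (k : nat) : P :=
  \sum_(A : {set 'I_N.+1} | [&& #|A| == k, ord_max \notin A & p \notin A])
     \prod_(i in A) 'X_i.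

Lemma sigma0 : sigma R N 0 = 1.
Proof.
rewrite /sigma (big_pred1 set0) => [|A /=]; first by rewrite big_set0.
rewrite cards_eq0; case: eqP => // ->; by rewrite in_set0.
Qed.

Lemma sigma_omit0 p : sigma_omit p 0 = 1.
Proof.
rewrite /sigma_omit (big_pred1 set0) => [|A /=]; first by rewrite big_set0.
rewrite cards_eq0; case: eqP => // ->; by rewrite !in_set0.
Qed.

Lemma sigma_gt k : (N < k)%N -> sigma R N k = 0.
Proof.
move=> ltNk; rewrite /sigma big_pred0 // => A; apply/negbTE/negP.
case/andP=> /eqP cA mA; have := max_card (ord_max |: A).
by rewrite cardsU1 mA card_ord cA; lia.
Qed.

(** Sets avoiding [p] give the first term; those containing it are [p |: B] with [B] avoiding it. *)
Lemma sigma_split p k : p != ord_max ->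
  sigma R N k.+1 = sigma_omit p k.+1 + 'X_p * sigma_omit p k.
Proof.
move=> pm; rewrite /sigma (bigID (fun A : {set _} => p \in A)) [LHS]addrC /=.
congr (_ + _).
  by apply: eq_bigl => A; rewrite -andbA.
rewrite /sigma_omit mulr_sumr.
rewrite (reindex_onto (fun B => p |: B) (fun A => A :\ p)) /=; last first.
  by move=> A /andP[_ pA]; rewrite setD1K.
apply: eq_big => [B|B].
  rewrite setU11 andbT cardsU1 in_setU1 [ord_max == p]eq_sym (negbTE pm) /=.
  have [pB|pB] := boolP (p \in B); last first.
    by rewrite setU1K // eqxx !andbT.
  rewrite !andbF; apply/negbTE/negP=> /andP[_ /eqP eB].
  by move: pB; rewrite -eB setD11.
case/andP=> _ /eqP eB; rewrite big_setU1 //.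
by rewrite -eB setD11.
Qed.

Lemma mderiv_sigma_omit p k : mderiv p (sigma_omit p k) = 0.
Proof.
rewrite raddf_sum big1 // => A /and3P[_ _ pA] /=; exact: mderiv_prod_notin.
Qed.

Lemma mderiv_sigma p k : p != ord_max ->
  mderiv p (sigma R N k.+1) = sigma_omit p k.
Proof.
move=> pm; rewrite (sigma_split p) // mderivD mderivM !mderiv_sigma_omit.
by rewrite mderiv_var eqxx mulr0 addr0 add0r mul1r.
Qed.

Lemma mderiv_sigma_max k : mderiv ord_max (sigma R N k) = 0.
Proof.
rewrite raddf_sum big1 // => A /andP[_ mA] /=; exact: mderiv_prod_notin.
Qed.

(** Indexed by weight, one more than the index of [s_u], and unbounded in [r] so that the
    recurrences may leave the range r <= N. *)
Definition scoord (r : nat) : P :=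
  \sum_(n < r.+1) (-1) ^+ n *: (sigma R N (r - n) * v ^+ n).

Lemma s_uE (r : 'I_N.+1) : r != ord_max -> s_u R N r = scoord r.+1.
Proof. by rewrite /s_u => /negbTE->. Qed.

Lemma scoord0 : scoord 0 = 1.
Proof. by rewrite /scoord big_ord1 expr0 scale1r expr0 mulr1 sigma0. Qed.

Lemma scoordS r : scoord r.+1 = sigma R N r.+1 - v * scoord r.
Proof.
rewrite /scoord big_ord_recl /= expr0 scale1r expr0 mulr1; congr (_ + _).
rewrite mulr_sumr -sumrN; apply: eq_bigr => n _.
rewrite /bump /= !exprS subSS mulN1r scaleNr -scalerAr.
by congr (- (_ *: _)); ring.
Qed.

Lemma scoord_gt r : (N <= r)%N -> scoord r.+1 = - v * scoord r.
Proof. by move=> leNr; rewrite scoordS sigma_gt // sub0r mulNr. Qed.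

(** The coefficient of t^b in S(t) / (1 + u^p t), where S(t) = sum_r s^r t^r is the product of the 1
    + u^i t (i <= N) over 1 + v t. Differentiating S by u^p multiplies it by e_p t / (1 + u^p t). *)
Fixpoint gcoord (p : 'I_N.+1) (b : nat) : P :=
  if b is c.+1 then scoord b - 'X_p * gcoord p c else 1.

Definition esign (p : 'I_N.+1) : P := (-1) ^+ (p == ord_max).

Lemma mderiv_scoord p b : mderiv p (scoord b.+1) = esign p * gcoord p b.
Proof.
rewrite /esign; have [->|pm] := eqVneq p ord_max.
  rewrite expr1 mulN1r; elim: b => [|b IHb].
    rewrite scoordS scoord0 mderivB mderiv_sigma_max mderivM mderiv1.
    by rewrite mderiv_var eqxx /=; ring.
  rewrite scoordS mderivB mderiv_sigma_max mderivM IHb mderiv_var eqxx /=.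
  by ring.
rewrite expr0 mul1r.
have dS c : mderiv p (scoord c.+1) = sigma_omit p c - v * mderiv p (scoord c).
  rewrite scoordS mderivB mderiv_sigma // mderivM mderiv_var (negbTE pm).
  by rewrite mul0r add0r.
(* Solved for the derivative of [scoord c.+1], this is the recurrence defining [gcoord]. *)
have SE c : scoord c = mderiv p (scoord c.+1) + 'X_p * mderiv p (scoord c).
  elim: c => [|c IHc]; first by rewrite dS scoord0 mderiv1 sigma_omit0; ring.
  by rewrite {1}scoordS (sigma_split p) // IHc !dS; ring.
elim: b => [|b IHb]; first by rewrite dS scoord0 mderiv1 mulr0 subr0 sigma_omit0.
by rewrite /= -IHb [X in _ = X - _]SE addrK.
Qed.

Definition euler_op (q : P) : P := \sum_p 'X_p * mderiv p q.

Lemma euler_opB : zmod_morphism euler_op.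
Proof.
move=> x y; rewrite /euler_op -sumrB; apply: eq_bigr => p _.
by rewrite mderivB mulrBr.
Qed.

HB.instance Definition _ := GRing.isZmodMorphism.Build P P euler_op euler_opB.

Lemma euler_opM x y : euler_op (x * y) = euler_op x * y + x * euler_op y.
Proof.
rewrite /euler_op mulr_suml mulr_sumr -big_split; apply: eq_bigr => p _ /=.
by rewrite mderivM; ring.
Qed.

Lemma euler_op_var p : euler_op 'X_p = 'X_p.
Proof.
rewrite /euler_op (bigD1 p) //= mderiv_var eqxx mulr1 big1 ?addr0 // => q qp.
by rewrite mderiv_var (negbTE qp) mulr0.
Qed.

Lemma euler_op_sigma k : euler_op (sigma R N k) = k%:R * sigma R N k.
Proof.
rewrite raddf_sum mulr_sumr; apply: eq_bigr => A /andP[/eqP <- _] /=.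
rewrite -sum1_card; elim/big_rec2: _ => [|p n x _ IH].
  by rewrite /euler_op big1 ?mul0r // => p _; rewrite mderiv1 mulr0.
by rewrite euler_opM euler_op_var IH natrD; ring.
Qed.

Lemma euler_op_scoord r : euler_op (scoord r) = r%:R * scoord r.
Proof.
elim: r => [|r IHr]; first by rewrite scoord0 -sigma0 euler_op_sigma.
rewrite scoordS raddfB /= euler_op_sigma euler_opM euler_op_var IHr.
by rewrite -[r.+1]addn1 natrD; ring.
Qed.

(** Euler's identity for s^a, homogeneous of degree [a]: each summand is u^p times the derivative of
    s^a by u^p. *)
Lemma gcoord_euler a :
  \sum_p esign p * (scoord a - gcoord p a) = a%:R * scoord a.
Proof.
rewrite -euler_op_scoord; apply: eq_bigr => p _.
case: a => [|a]; first by rewrite scoord0 mderiv1 /= subrr !mulr0.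
by rewrite mderiv_scoord /=; ring.
Qed.

End Coordinates.

(** * Invertibility of the Jacobian and the derivations d/ds^k *)

Section Jacobian.

Variables (R : numFieldType) (N : nat).
Local Notation K := (RatFun R N).
Local Notation P := {mpoly R[N.+1]}.
Local Notation S := (scoord R N).
Local Notation G := (gcoord R N).
Local Notation esign := (esign R N).

(** The recurrence of [gcoord] with u^p made an indeterminate, so that all columns of the Jacobian
    evaluate the same polynomials. *)
Fixpoint gpoly (b : nat) : {poly K} :=
  if b is c.+1 then ((S b)%:F)%:P - gpoly c * 'X else 1.

Lemma horner_gpoly p b : (gpoly b).[('X_p)%:F] = (G p b)%:F.
Proof.
elim: b => [|b IHb] /=; first by rewrite hornerC tofrac1.
by rewrite hornerD hornerN hornerMX hornerC IHb tofracB tofracM mulrC.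
Qed.

Lemma size_gpoly b : (size (gpoly b) <= b.+1)%N.
Proof.
elim: b => [|b IHb] /=; first by rewrite size_polyC leq_b1.
rewrite (leq_trans (size_polyD _ _)) // geq_max size_polyN.
rewrite (leq_trans (size_polyC_leq1 _)) //=.
by rewrite (leq_trans (size_polyMleq _ _)) // size_polyX addn2.
Qed.

Lemma coef_gpoly b : (gpoly b)`_b = (-1) ^+ b.
Proof.
elim: b => [|b IHb] /=; first by rewrite coefC.
by rewrite coefB coefC coefMX /= IHb exprS mulN1r sub0r.
Qed.

(** [gpoly r] has degree exactly [r], so the top coefficient isolates the last weight. *)
Lemma gpoly_free (w : nat -> K) n :
  \sum_(r < n) w r *: gpoly r = 0 -> forall r, (r < n)%N -> w r = 0.
Proof.
elim: n => [//|n IHn]; rewrite big_ord_recr /= => sum0.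
have wn0 : w n = 0.
  move/(congr1 (fun q : {poly K} => q`_n)): sum0.
  rewrite coefD coef_sum big1 => [|r _]; last first.
    by rewrite coefZ nth_default ?mulr0 // (leq_trans (size_gpoly r)).
  rewrite coefZ coef_gpoly coef0 add0r => /eqP.
  by rewrite mulf_eq0 signr_eq0 orbF => /eqP.
move=> r; rewrite ltnS leq_eqVlt => /predU1P[-> //|].
by apply: IHn; rewrite wn0 scale0r addr0 in sum0.
Qed.

Lemma jacE (i p : 'I_N.+1) : i != ord_max ->
  jac R N i p = (esign p * G p i)%:F.
Proof. by move=> im; rewrite mxE s_uE // mderiv_scoord. Qed.

Lemma jac_max (p : 'I_N.+1) : jac R N ord_max p = (p == ord_max)%:R.
Proof.
by rewrite mxE /s_u eqxx mderiv_var; case: eqP; rewrite ?tofrac1 ?tofrac0.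
Qed.

(* A left kernel vector of the Jacobian gives a polynomial of degree < N with
   the N distinct roots u^1, ..., u^N. *)
Lemma jac_unit : jac R N \in unitmx.
Proof.
rewrite -row_free_unit -kermx_eq0; apply/eqP/row_matrixP=> l.
rewrite row0; set w := row l _.
have wJ : w *m jac R N = 0 by apply/sub_kermxP/row_sub.
(* The last entry of [w] is kept apart: row [ord_max] is the gradient of u^(N+1) and vanishes in the
   first N columns. *)
pose wn n := if (n < N)%N then w 0 (inord n) else 0.
have wJE q : \sum_(r < N) wn r * jac R N (inord r) q
             + w 0 ord_max * jac R N ord_max q = 0.
  move/matrixP/(_ 0 q): wJ; rewrite mxE [RHS]mxE big_ord_recr /= => eq0.
  rewrite -[RHS]eq0.
  congr (_ + _). apply: eq_bigr => r _.
  rewrite /wn ltn_ord; have -> : inord r = widen_ord (leqnSn N) r; last by [].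
  by apply/val_inj; rewrite /= inordK // ltnS ltnW.
have inordN (r : 'I_N) : @inord N r != ord_max.
  by rewrite -val_eqE /= inordK ?ltnS 1?ltnW // neq_ltn ltn_ord.
pose Q := \sum_(r < N) wn r *: gpoly r.
have Q0 : Q = 0.
  apply: contraTeq isT => nzQ.
  pose rs := [seq ('X_(widen_ord (leqnSn N) p))%:F : K | p <- enum 'I_N].
  have rootQ : all (root Q) rs.
    apply/allP=> _ /mapP[p _ ->]; set p' := widen_ord _ p.
    have pm : p' != ord_max by rewrite -val_eqE /= neq_ltn ltn_ord.
    apply/eqP; rewrite horner_sum -[RHS](wJE p') jac_max (negbTE pm) mulr0 addr0.
    apply: eq_bigr => r _; rewrite hornerZ horner_gpoly jacE // /esign.
    by rewrite (negbTE pm) expr0 mul1r inordK // ltnS ltnW.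
  (* Distinct variables are separated by a partial derivative. *)
  have uniq_rs : uniq rs.
    rewrite map_inj_uniq ?enum_uniq // => p q /eqP; rewrite tofrac_eq => /eqP.
    move/(congr1 (mderiv (widen_ord (leqnSn N) p))); rewrite !mderiv_var eqxx.
    case: eqP => [/(congr1 val) /= /val_inj //|_ /eqP].
    by rewrite oner_eq0.
  have := max_poly_roots nzQ rootQ uniq_rs.
  rewrite size_map size_enum_ord ltnNge; case/negP.
  apply: (leq_trans (size_sum _ _ _)); apply/bigmax_leqP=> r _.
  by rewrite (leq_trans (size_scale_leq _ _)) // (leq_trans (size_gpoly r)).
have wn0 := gpoly_free wn N Q0.
have wmax : w 0 ord_max = 0.
  have := wJE ord_max; rewrite jac_max eqxx mulr1 big1 ?add0r // => r _.
  by rewrite wn0 ?mul0r.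
apply/rowP=> i; rewrite [RHS]mxE.
have [->//|im] := eqVneq i ord_max.
have ltiN : (i < N)%N by rewrite ltn_neqAle -ltnS ltn_ord andbT -val_eqE in im *.
by have := wn0 i ltiN; rewrite /wn ltiN inord_val.
Qed.

Lemma sderiv_tofrac k (q : P) :
  sderiv R N k q%:F = \sum_r jacinv R N r k * (mderiv r q)%:F.
Proof. by apply: eq_bigr => r _; rewrite fderiv_tofrac. Qed.

(** An entry of J J^(-1) = 1; this is where invertibility enters. *)
Lemma sderiv_s_u k i : sderiv R N k (s_u R N i)%:F = (i == k)%:R.
Proof.
have /matrixP/(_ i k) := mulmxV jac_unit; rewrite !mxE => <-.
by rewrite sderiv_tofrac; apply: eq_bigr => r _; rewrite mulrC !mxE.
Qed.

Lemma sderiv_var k p : sderiv R N k ('X_p)%:F = jacinv R N p k.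
Proof.
rewrite sderiv_tofrac (bigD1 p) //= mderiv_var eqxx tofrac1 mulr1.
rewrite big1 ?addr0 // => q qp.
by rewrite mderiv_var (negbTE qp) tofrac0 mulr0.
Qed.

Lemma sderiv_scoord_chain k b :
  sderiv R N k (S b.+1)%:F
  = \sum_p (esign p)%:F * (G p b)%:F * sderiv R N k ('X_p)%:F.
Proof.
rewrite sderiv_tofrac; apply: eq_bigr => p _.
by rewrite sderiv_var mderiv_scoord tofracM mulrC.
Qed.

End Jacobian.

(** * The transformed pair in terms of E_p s^i *)

Section Affine.

Arguments gcoord : simpl never.

Variables (R : numFieldType) (N : nat).
Local Notation K := (RatFun R N).
Local Notation P := {mpoly R[N.+1]}.
Local Notation s a := ((scoord R N a)%:F : K).
Local Notation G p a := ((gcoord R N p a)%:F : K).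
Local Notation u p := (('X_p : P)%:F : K).
Local Notation v := (u (@ord_max N)).
Local Notation eps p := ((esign R N p)%:F : K).
Local Notation d k := (sderiv R N k).

Definition ejac (i p : 'I_N.+1) : K := jac R N i p * u p.

Lemma eps_sqr p : eps p * eps p = 1.
Proof. by rewrite -tofracM -expr2 sqrr_sign tofrac1. Qed.

Lemma sderiv_nat k n : d k n%:R = 0.
Proof. by rewrite raddfMn /= sderiv1 mul0rn. Qed.

Lemma sderiv_eps k p : d k (eps p) = 0.
Proof.
rewrite /esign; case: eqP => _; rewrite ?expr1 ?expr0 ?tofracN tofrac1.
  by rewrite raddfN /= sderiv1 oppr0.
exact: sderiv1.
Qed.

(** Diagonal entries: 2 - N = 1 + (1 - N) and N = 1 - (1 - N). The all-ones part will split double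
    sums into products. *)
Lemma mcoefE p q :
  ((mcoef R N p q)%:MP)%:F = 1 + (p == q)%:R * ((1 - N%:R) * eps p) :> K.
Proof.
rewrite /mcoef /esign; case: eqP => _; last by rewrite mul0r addr0 tofrac1.
case: eqP => _; rewrite ?mpolyCB !mpolyC_nat ?tofracB ?tofracMn ?expr0 ?expr1;
  rewrite ?tofracN !tofrac1 mul1r; ring.
Qed.

Lemma sum_mcoef (x y : 'I_N.+1 -> K) :
  \sum_p \sum_q ((mcoef R N p q)%:MP)%:F * (x p * y q)
  = (\sum_p x p) * (\sum_q y q)
    + (1 - N%:R) * \sum_p eps p * x p * y p.
Proof.
rewrite mulr_suml mulr_sumr -big_split; apply: eq_bigr => p _ /=.
rewrite mulr_sumr (bigD1 p) //= mcoefE eqxx mul1r [in RHS](bigD1 p) //=.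
rewrite (eq_bigr (fun q => x p * y q)) => [|q qp].
  by rewrite mulrDl mul1r addrAC !mulrA.
by rewrite mcoefE eq_sym (negbTE qp) mul0r addr0 mul1r.
Qed.

Lemma g_sE i j :
  g_s R N i j = (\sum_p ejac i p) * (\sum_q ejac j q)
    + (1 - N%:R) * \sum_p eps p * ejac i p * ejac j p.
Proof.
rewrite -sum_mcoef; apply: eq_bigr => p _; apply: eq_bigr => q _.
by rewrite /g_u -mul_mpolyC !tofracM /ejac; ring.
Qed.

Lemma sderiv_jac k j q :
  d k (jac R N j q) = \sum_r jacinv R N r k * hess R N j q r.
Proof. by rewrite mxE sderiv_tofrac. Qed.

(** Leibniz on E_q s^j = (ds^j/du^q) u^q: differentiating the Jacobian entry gives the Hessian term,
    differentiating u^q the [Gam_u] term, which lives on [r = q]. *)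
Lemma Gam_sE i j k :
  Gam_s R N i j k = (\sum_p ejac i p) * d k (\sum_q ejac j q)
    + (1 - N%:R) * \sum_p eps p * ejac i p * d k (ejac j p).
Proof.
rewrite raddf_sum -sum_mcoef; apply: eq_bigr => p _; apply: eq_bigr => q _.
rewrite /= {2}/ejac sderivM sderiv_var big_split /= mulrDr mulrDr addrC.
congr (_ + _).
  rewrite sderiv_jac mulr_suml !mulr_sumr; apply: eq_bigr => r _.
  by rewrite /g_u -mul_mpolyC !tofracM /ejac; ring.
rewrite (bigD1 q) //= big1 => [|r rq].
  by rewrite /Gam_u eqxx -mul_mpolyC !tofracM /ejac; ring.
by rewrite /Gam_u eq_sym (negbTE rq) tofrac0 mulr0.
Qed.

Lemma gcoord_fracS p b : G p b.+1 = s b.+1 - u p * G p b.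
Proof. by rewrite tofracB tofracM. Qed.

Lemma ejacE (i p : 'I_N.+1) : i != ord_max ->
  ejac i p = eps p * (s i.+1 - G p i.+1).
Proof. by move=> im; rewrite /ejac jacE // tofracM gcoord_fracS; ring. Qed.

Lemma ejac_max p : ejac ord_max p = (p == ord_max)%:R * v.
Proof.
by rewrite /ejac jac_max; case: eqP => [->//|_]; rewrite !mul0r.
Qed.

Lemma euler_frac a : \sum_p eps p * (s a - G p a) = a%:R * s a.
Proof.
have /(congr1 (@FracField.tofrac _)) := gcoord_euler R N a.
rewrite rmorph_sum rmorphM rmorph_nat /= => <-.
by apply: eq_bigr => p _; rewrite tofracM tofracB.
Qed.

Lemma sum_ejac i : i != ord_max -> \sum_p ejac i p = i.+1%:R * s i.+1.
Proof.
by move=> im; rewrite -euler_frac; apply: eq_bigr => p _; rewrite ejacE.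
Qed.

Lemma sum_ejac_max_mul (x : 'I_N.+1 -> K) :
  \sum_p ejac ord_max p * x p = v * x ord_max.
Proof.
rewrite (bigD1 ord_max) //= ejac_max eqxx mul1r big1 ?addr0 // => p pm.
by rewrite ejac_max (negbTE pm) !mul0r.
Qed.

Lemma sum_ejac_max : \sum_p ejac ord_max p = v.
Proof.
rewrite -[RHS]mulr1 -(sum_ejac_max_mul (fun=> 1)).
by apply: eq_bigr => p; rewrite mulr1.
Qed.

Lemma sderiv_v k : d k v = (ord_max == k)%:R.
Proof. by rewrite -sderiv_s_u /s_u eqxx. Qed.

Lemma sderiv_scoord k r : (r < N)%N -> d k (s r.+1) = (inord r == k)%:R.
Proof.
move=> ltrN; have rE : @inord N r = r :> nat by rewrite inordK // ltnS ltnW.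
by rewrite -sderiv_s_u s_uE ?rE // -val_eqE /= rE neq_ltn ltrN.
Qed.

(** * Dependence on s^(N-1), with [D] = d/ds^(N-1) *)

Hypothesis hN : (2 <= N)%N.
Local Notation D := (sderiv R N (inord (N - 2))).

Lemma inord_max : @inord N (N - 2) != ord_max.
Proof. by rewrite -val_eqE /= inordK; lia. Qed.

Lemma Dv : D v = 0.
Proof. by rewrite sderiv_v eq_sym (negbTE inord_max). Qed.

Lemma D_sderiv_v k : D (d k v) = 0.
Proof. by rewrite sderiv_v sderiv_nat. Qed.

Lemma DDM x y : D (D (x * y)) = D (D x) * y + D x * D y *+ 2 + x * D (D y).
Proof. by rewrite !(sderivM, raddfD) /= !sderivM; ring. Qed.

Lemma DDB x y : D (D (x - y)) = D (D x) - D (D y).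
Proof. by rewrite !raddfB. Qed.

Lemma DD_mull c x : D c = 0 -> D (D (c * x)) = c * D (D x).
Proof. by move=> c0; rewrite !sderivM c0 mul0r add0r sderivM c0 mul0r add0r. Qed.

Lemma DD_mulr c x : D c = 0 -> D (D (x * c)) = D (D x) * c.
Proof. by move=> c0; rewrite mulrC DD_mull // mulrC. Qed.

Lemma scoord_fracS n : (s (N + n.+1)%N) = - (v * (s (N + n)%N)).
Proof. by rewrite addnS scoord_gt ?leq_addr // mulNr tofracN tofracM. Qed.

(** [s c] is 1, a coordinate, or (-v)^(c-N) s^N according as c = 0, 1 <= c <= N, or c > N. *)
Lemma D_scoord c : D (s c) = (c == N.-1)%:R.
Proof.
case: c => [|c]; first by rewrite scoord0 tofrac1 sderiv1; case: eqP => //; lia.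
have [ltcN|leNc] := ltnP c N.
  rewrite sderiv_scoord // -val_eqE /= !inordK; try lia.
  by congr (nat_of_bool _)%:R; apply/eqP/eqP; lia.
have -> : (c.+1 == N.-1) = false by apply/eqP; lia.
have -> : c.+1 = (N + (c - N).+1)%N by lia.
move: (c - N)%N => n; rewrite scoord_fracS raddfN /= sderivM Dv mul0r add0r.
suff -> : D (s (N + n)%N) = 0 by rewrite mulr0 oppr0.
elim: n => [|n IHn]; last first.
  by rewrite scoord_fracS raddfN /= sderivM Dv mul0r add0r IHn mulr0 oppr0.
have -> : (N + 0 = N.-1.+1)%N by lia.
rewrite sderiv_scoord; last by lia.
by rewrite -val_eqE /= !inordK; try lia; case: eqP => //; lia.
Qed.

(** Up to c = N the derivative is constant; beyond, it involves only v and s^N. *)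
Lemma D_sderiv_scoord k c : D (d k (s c)) = 0.
Proof.
have lt_case e : (e <= N)%N -> D (d k (s e)) = 0.
  case: e => [|e] le_eN; first by rewrite scoord0 tofrac1 sderiv1 raddf0.
  by rewrite sderiv_scoord // sderiv_nat.
have [/lt_case//|ltNc] := leqP c N.
have -> : c = (N + (c - N))%N by lia.
elim: (c - N)%N => [|n IHn]; first by rewrite addn0 lt_case.
rewrite scoord_fracS !raddfN /= sderivM raddfD /= !sderivM D_sderiv_v Dv IHn.
rewrite D_scoord; have -> : (N + n == N.-1)%N = false by apply/eqP; lia.
by rewrite !(mul0r, mulr0, addr0) oppr0.
Qed.

(** At [ord_max] the multiplier in the recurrence is the coordinate v, which [D] kills, so
    affineness propagates. *)
Lemma DD_gcoord a : D (D (G ord_max a)) = 0.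
Proof.
elim: a => [|a IHa]; first by rewrite tofrac1 sderiv1 raddf0.
by rewrite gcoord_fracS !raddfB /= D_sderiv_scoord DD_mull ?Dv // IHa mulr0 subr0.
Qed.

Lemma DD_sderiv_gcoord k a : D (D (d k (G ord_max a))) = 0.
Proof.
elim: a => [|a IHa]; first by rewrite tofrac1 sderiv1 !raddf0.
rewrite gcoord_fracS raddfB /= sderivM !raddfB /= !raddfD /= D_sderiv_scoord.
rewrite raddf0 DD_mull ?D_sderiv_v // DD_gcoord DD_mull ?Dv // IHa.
by rewrite !(mulr0, addr0, oppr0).
Qed.

Lemma DD_ejac i : D (D (ejac i ord_max)) = 0.
Proof.
have [->|im] := eqVneq i ord_max; first by rewrite ejac_max eqxx mul1r Dv raddf0.
rewrite ejacE // DD_mull ?sderiv_eps // DDB D_sderiv_scoord DD_gcoord.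
by rewrite subr0 mulr0.
Qed.

Lemma DD_sderiv_ejac k i : D (D (d k (ejac i ord_max))) = 0.
Proof.
have [->|im] := eqVneq i ord_max.
  by rewrite ejac_max eqxx mul1r D_sderiv_v raddf0.
rewrite ejacE // sderivM sderiv_eps mul0r add0r DD_mull ?sderiv_eps //.
by rewrite (raddfB (d k)) DDB D_sderiv_scoord DD_sderiv_gcoord raddf0 subr0 mulr0.
Qed.

Lemma D_sderiv_sum_ejac k i : D (d k (\sum_p ejac i p)) = 0.
Proof.
have [->|im] := eqVneq i ord_max.
  by rewrite sum_ejac_max D_sderiv_v.
rewrite sum_ejac // sderivM sderiv_nat mul0r add0r sderivM sderiv_nat mul0r.
by rewrite D_sderiv_scoord mulr0 addr0.
Qed.

Lemma D_coef : D (1 - N%:R) = 0.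
Proof. by rewrite raddfB /= sderiv1 sderiv_nat subr0. Qed.

Lemma sum_eps_ejac_max (x : 'I_N.+1 -> K) :
  \sum_p eps p * ejac ord_max p * x p = - (v * x ord_max).
Proof.
rewrite (eq_bigr (fun p => ejac ord_max p * (eps p * x p))) => [|p _]; last by ring.
by rewrite sum_ejac_max_mul /esign eqxx expr1 tofracN tofrac1; ring.
Qed.

Lemma g_s_affine i j : D (D (g_s R N i j)) = 0.
Proof.
(* By symmetry of [g_s], a lone index [ord_max] may be taken to be [i]. *)
wlog ji : i j / (i == ord_max) || (j != ord_max).
  move=> IH; have [im|im] := boolP (i == ord_max); first by apply: IH; rewrite im.
  have [jm|jm] := boolP (j == ord_max); last by apply: IH; rewrite jm orbT.
  have -> : g_s R N i j = g_s R N j i; last by apply: IH; rewrite jm.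
  rewrite !g_sE mulrC; congr (_ + _ * _); apply: eq_bigr => p _; ring.
rewrite g_sE !raddfD /= [X in _ + X]DD_mull ?D_coef //.
have [im|im] := eqVneq i ord_max.
  rewrite im sum_eps_ejac_max sum_ejac_max DD_mull ?Dv // D_sderiv_sum_ejac.
  by rewrite !raddfN /= DD_mull ?Dv // DD_ejac !mulr0 oppr0 mulr0 addr0.
have jm : j != ord_max by rewrite (negbTE im) in ji.
rewrite !sum_ejac // DDM !sderivM !sderiv_nat !raddfD /= !sderivM !sderiv_nat.
rewrite !D_scoord !sderiv_nat.
rewrite (eq_bigr (fun p => eps p * (s i.+1 - G p i.+1) * (s j.+1 - G p j.+1))).
  (* Here [z = 2] is the second derivative of the square of s^(N-1). *)
  have := sum_FF_additive _ _ (fun p => u p) (fun p => eps p)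
    (fun a => (s a)) (fun p a => G p a) _ _ _ euler_frac (D \o D) N.-1 2.
  move=> /= ->; first last.
  - move=> c e; rewrite DDM !D_sderiv_scoord !D_scoord.
    by case: eqP; case: eqP => _ _ /=; ring.
  - by move=> p a; rewrite gcoord_fracS.
  - by move=> p; rewrite tofrac1.
  - by rewrite scoord0 tofrac1.
  have [ei|_] := eqVneq i.+1 N.-1; have [ej|_] := eqVneq j.+1 N.-1 => /=;
    last first.
  - by ring.
  - by ring.
  - by ring.
  rewrite ei ej; have -> : N%:R = N.-1%:R + 1 :> K by rewrite natr1 prednK //; lia.
  by rewrite -mulr_natr; ring.
(* Each [ejac] carries a sign, so three signs reduce to one. *)
move=> p _; rewrite !ejacE // -[RHS]mul1r -(eps_sqr p); ring.
Qed.

Lemma Gam_s_affine i j k : D (D (Gam_s R N i j k)) = 0.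
Proof.
rewrite Gam_sE !raddfD /= [X in _ + X]DD_mull ?D_coef //.
(* The rank-one part is an affine factor times one free of s^(N-1). *)
rewrite DD_mulr ?D_sderiv_sum_ejac // mul0r add0r.
have [->|im] := eqVneq i ord_max.
  rewrite (sum_eps_ejac_max (fun p => d k (ejac j p))) !raddfN /=.
  by rewrite DD_mull ?Dv // DD_sderiv_ejac mulr0 oppr0 mulr0.
have [->|jm] := eqVneq j ord_max.
  rewrite (bigD1 ord_max) //= big1 => [|p pm]; last first.
    by rewrite ejac_max (negbTE pm) mul0r raddf0 mulr0.
  rewrite addr0 ejac_max eqxx mul1r DD_mulr ?D_sderiv_v //.
  by rewrite DD_mull ?sderiv_eps // DD_ejac !(mulr0, mul0r).
rewrite (eq_bigr (fun p => eps p * (s i.+1 - G p i.+1)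
                            * d k (s j.+1 - G p j.+1))).
  have := sum_FdF_additive _ _ (fun p => u p) (fun p => eps p)
    (fun a => (s a)) (fun p a => G p a) _ _ _ euler_frac (d k) (sderivM R N k)
    (sderiv_eps k) (sderiv_scoord_chain R N k) (D \o D).
  move=> /= ->; first by rewrite mulr0.
  - by rewrite scoord0 tofrac1.
  - by move=> p; rewrite tofrac1.
  - by move=> p a; rewrite gcoord_fracS.
  (* [s c] is affine in s^(N-1) and [d k (s e)] is free of it. *)
  - by move=> c e; rewrite DD_mulr ?D_sderiv_scoord // mul0r.
move=> p _; rewrite !ejacE // sderivM sderiv_eps mul0r add0r.
rewrite -[RHS]mul1r -(eps_sqr p); ring.
Qed.

End Affine.

(* s^(N-1) has 0-based index N-2, i.e. [inord (N - 2)] in 'I_N.+1 *)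
Theorem theorem10 (R : numFieldType) (N : nat) (hN : (2 <= N)%N) :
  (forall i j : 'I_N.+1,
      affine_in_s R N (inord (N - 2)) (g_s R N i j)) /\
  (forall i j k : 'I_N.+1,
      affine_in_s R N (inord (N - 2)) (Gam_s R N i j k)).
Proof.
by split=> *; [apply: g_s_affine | apply: Gam_s_affine].
Qed.
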